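(* Let $\mathcal{P}_v$ be the set of vectors ($\Re$-equivalence classes of arrows) of an arrow space $\mathcal{P}_A$ satisfying Axioms 1, 2, 4, 5 stated in the context. For any $[\overrightarrow{AB}]\in\mathcal{P}_v$, $[\overrightarrow{AB}]+_V[-\overrightarrow{AB}]=[\overrightarrow{AA}]$.
   Context: Let $\mathcal{P}$ be an infinite set whose elements are called points. An arrow is an ordered pair of points $\overrightarrow{AB}=(A,B)$ (tail $A$, head $B$; $A=B$ is allowed). The arrow space $\mathcal{P}_A$ is the set of all arrows; two arrows are equal iff they have the same tail and the same head. Negation: $-\overrightarrow{AB}=\overrightarrow{BA}$. Arrow addition is the partial operation $\overrightarrow{AB}+_A\overrightarrow{BC}=\overrightarrow{AC}$, defined exactly when the head of the first arrow equals the tail of the second. Axiom 1: there is a given map (arrow pre-inner product) $\langle -,-\rangle_A:\mathcal{P}_A\times\mathcal{P}_A\to\mathbb{R}$ such that for all points: $\langle\overrightarrow{AB},\overrightarrow{AB}\rangle_A\ge 0$, with equality iff $A=B$; $\langle\overrightarrow{AB},\overrightarrow{CD}\rangle_A=\langle\overrightarrow{CD},\overrightarrow{AB}\rangle_A$; $\langle\overrightarrow{AB}+_A\overrightarrow{BC},\overrightarrow{LM}\rangle_A=\langle\overrightarrow{AB},\overrightarrow{LM}\rangle_A+\langle\overrightarrow{BC},\overrightarrow{LM}\rangle_A$; $\langle-\overrightarrow{AB},\overrightarrow{CD}\rangle_A=-\langle\overrightarrow{AB},\overrightarrow{CD}\rangle_A$. Measure: $\|\overrightarrow{AB}\|_A=\sqrt{\langle\overrightarrow{AB},\overrightarrow{AB}\rangle_A}$.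 Scalar multiplication: for $t\in\mathbb{R}$, if $A=B$ or $t=0$ then $(t)\overrightarrow{AB}=\overrightarrow{AA}$. If $A\ne B$ and $t\neq0$ then $(t)\overrightarrow{AB}=\overrightarrow{AD}$, where $D\in\mathcal{P}$ is a point (assumed to exist) with $\|\overrightarrow{AD}\|_A=|t|\,\|\overrightarrow{AB}\|_A$ and $\langle\overrightarrow{AB},\overrightarrow{AD}\rangle_A=\|\overrightarrow{AB}\|_A\|\overrightarrow{AD}\|_A$ if $t>0$, $=-\|\overrightarrow{AB}\|_A\|\overrightarrow{AD}\|_A$ if $t<0$. Axiom 2: $\langle(t)\overrightarrow{AB},\overrightarrow{CD}\rangle_A=t\langle\overrightarrow{AB},\overrightarrow{CD}\rangle_A$ for all arrows and all $t\in\mathbb{R}$. Relation $\Re$ on $\mathcal{P}_A$: $\overrightarrow{AB}\;\Re\;\overrightarrow{CD}$ iff either $A=B$ and $C=D$, or ($A\ne B$, $C\neq D$ and) $\|\overrightarrow{AB}\|_A=\|\overrightarrow{CD}\|_A$ and $\frac{\langle\overrightarrow{AB},\overrightarrow{CD}\rangle_A}{\|\overrightarrow{AB}\|_A\|\overrightarrow{CD}\|_A}=1$. Axiom 4: if $\overrightarrow{AB}\;\Re\;\overrightarrow{CD}$ and $\overrightarrow{EF}\;\Re\;\overrightarrow{GH}$, then $\langle\overrightarrow{AB},\overrightarrow{EF}\rangle_A=\langle\overrightarrow{CD},\overrightarrow{GH}\rangle_A$. (Then $\Re$ is an equivalence relation.) Axiom 5: for $A\neq B$ and any point $P$, there is a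 unique point $K$ with $\overrightarrow{AB}\;\Re\;\overrightarrow{PK}$ and a unique point $K'$ with $\overrightarrow{AB}\;\Re\;\overrightarrow{K'P}$. (For $A=B$ the same holds with $K=K'=P$.) Vectors: $\mathcal{P}_v$ is the set of $\Re$-equivalence classes $[\overrightarrow{AB}]$. Vector addition: given $[\overrightarrow{AB}],[\overrightarrow{CD}]$, choose any point $P$, let $K,L$ be the unique points with $\overrightarrow{KP}\;\Re\;\overrightarrow{AB}$ and $\overrightarrow{PL}\;\Re\;\overrightarrow{CD}$, and set $[\overrightarrow{AB}]+_V[\overrightarrow{CD}]=[\overrightarrow{KP}+_A\overrightarrow{PL}]=[\overrightarrow{KL}]$; this is well defined (independent of $P$ and of the representatives). *)

(* Defs.v *)
From Stdlib Require Import Reals Ensembles Finite_sets.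
From Stdlib Require Import IndefiniteDescription FunctionalExtensionality
  PropExtensionality ProofIrrelevance.
Open Scope R_scope.

Definition arrow (P : Type) : Type := (P * P)%type.
Definition tail {P : Type} (a : arrow P) : P := fst a.
Definition head {P : Type} (a : arrow P) : P := snd a.

Definition arrow_opp {P : Type} (a : arrow P) : arrow P := (head a, tail a).

(* Partial operation: the proof argument is its domain of definition. *)
Definition arrow_add {P : Type} (a b : arrow P) (_ : head a = tail b) : arrow P :=
  (tail a, head b).

Definition measure {P : Type} (ip : arrow P -> arrow P -> R) (a : arrow P) : R :=
  sqrt (ip a a).

Definition arrow_equiv {P : Type} (ip : arrow P -> arrow P -> R) (a b : arrow P) : Prop :=
  (tail a = head a /\ tail b = head b) \/
  (tail a <> head a /\ tail b <> head b /\
   measure ip a = measure ip b /\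
   ip a b / (measure ip a * measure ip b) = 1).

Record arrow_space : Type := ArrowSpace {
  point :> Type;
  point_infinite : ~ Finite point (Full_set point);

  inner : arrow point -> arrow point -> R;
  inner_ge0 : forall A B : point, 0 <= inner (A, B) (A, B);
  inner_eq0 : forall A B : point, inner (A, B) (A, B) = 0 <-> A = B;
  inner_sym : forall A B C D : point, inner (A, B) (C, D) = inner (C, D) (A, B);
  inner_add : forall A B C L M : point,
    inner (arrow_add (A, B) (B, C) eq_refl) (L, M) =
    inner (A, B) (L, M) + inner (B, C) (L, M);
  inner_opp : forall A B C D : point,
    inner (arrow_opp (A, B)) (C, D) = - inner (A, B) (C, D);

  (* The head D of a nondegenerate multiple is only required to exist; its
     uniqueness follows from [inner_scale]. *)
  scale : R -> arrow point -> arrow point;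
  scale_degenerate : forall (t : R) (A B : point),
    A = B \/ t = 0 -> scale t (A, B) = (A, A);
  scale_nondegenerate : forall (t : R) (A B : point),
    A <> B -> t <> 0 ->
    exists D : point,
      scale t (A, B) = (A, D) /\
      measure inner (A, D) = Rabs t * measure inner (A, B) /\
      (t > 0 -> inner (A, B) (A, D) = measure inner (A, B) * measure inner (A, D)) /\
      (t < 0 -> inner (A, B) (A, D) = - (measure inner (A, B) * measure inner (A, D)));
  inner_scale : forall (t : R) (A B C D : point),
    inner (scale t (A, B)) (C, D) = t * inner (A, B) (C, D);

  inner_equiv : forall A B C D E F G H : point,
    arrow_equiv inner (A, B) (C, D) -> arrow_equiv inner (E, F) (G, H) ->
    inner (A, B) (E, F) = inner (C, D) (G, H);

  transport_tail : forall A B P : point, A <> B ->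
    exists! K : point, arrow_equiv inner (A, B) (P, K);
  transport_head : forall A B P : point, A <> B ->
    exists! K' : point, arrow_equiv inner (A, B) (K', P)
}.

Arguments inner {a}.
Arguments scale {a}.

Definition aequiv {S : arrow_space} (a b : arrow S) : Prop := arrow_equiv inner a b.

Lemma aequiv_refl {S : arrow_space} (a : arrow S) : aequiv a a.
Proof.
destruct a as [A B].
destruct (Classical_Prop.classic (A = B)) as [e | n].
- left; split; exact e.
- right; repeat split; try exact n.
  unfold measure; rewrite sqrt_sqrt by apply inner_ge0.
  unfold Rdiv; apply Rinv_r; intro h; apply n; now apply inner_eq0.
Qed.

Lemma aequivP {S : arrow_space} (a b : arrow S) :
  aequiv a b <-> (forall c : arrow S, inner a c = inner b c).
Proof.
destruct a as [A B], b as [C D]; split.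
- intros h [E F]; apply inner_equiv; [exact h | apply aequiv_refl].
- intro h.
  assert (eA : inner (A, B) (A, B) = inner (A, B) (C, D)).
  { rewrite (inner_sym S A B C D), <- h; reflexivity. }
  assert (eC : inner (A, B) (A, B) = inner (C, D) (C, D)).
  { rewrite eA; apply h. }
  destruct (Classical_Prop.classic (A = B)) as [e | n].
  + left; split; [exact e |].
    apply (inner_eq0 S C D); rewrite <- eC; now apply inner_eq0.
  + assert (n0 : inner (A, B) (A, B) <> 0) by (intro z; apply n; now apply inner_eq0).
    right; repeat split; try exact n.
    * simpl; intro e; apply n0; rewrite eC; now apply inner_eq0.
    * unfold measure; now rewrite eC.
    * unfold measure; rewrite <- eC, sqrt_sqrt by apply inner_ge0.
      rewrite <- eA; unfold Rdiv; now apply Rinv_r.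
Qed.

Lemma transport_tail_all {S : arrow_space} (A B P : S) :
  exists! K : S, aequiv (A, B) (P, K).
Proof.
destruct (Classical_Prop.classic (A = B)) as [e | n].
- exists P; split; [left; split; [exact e | reflexivity] |].
  intros K [[_ h] | [h _]]; [exact h | now destruct h].
- now apply transport_tail.
Qed.

Definition vector (S : arrow_space) : Type :=
  { c : arrow S -> Prop | exists a : arrow S, c = aequiv a }.

Definition vclass {S : arrow_space} (a : arrow S) : vector S :=
  exist _ (aequiv a) (ex_intro _ a eq_refl).

Lemma vclass_eq {S : arrow_space} (a b : arrow S) :
  vclass a = vclass b <-> aequiv a b.
Proof.
split; intro h.
- apply (f_equal (@proj1_sig _ _)) in h; simpl in h.
  rewrite h; apply aequiv_refl.
- apply eq_sig_hprop; [intros; apply proof_irrelevance | simpl].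
  apply functional_extensionality; intro c; apply propositional_extensionality.
  rewrite !aequivP; rewrite aequivP in h.
  split; intros k d; [rewrite <- h | rewrite h]; apply k.
Qed.

Lemma vclass_surj {S : arrow_space} (u : vector S) :
  exists A B : S, u = vclass (A, B).
Proof.
destruct u as [c [[A B] e]]; exists A, B; subst c; reflexivity.
Qed.

Definition is_vsum {S : arrow_space} (u v w : vector S) : Prop :=
  exists A B C D P K L : S,
    u = vclass (A, B) /\ v = vclass (C, D) /\
    aequiv (K, P) (A, B) /\ aequiv (P, L) (C, D) /\
    w = vclass (arrow_add (K, P) (P, L) eq_refl).

Lemma is_vsum_ex_unique {S : arrow_space} (u v : vector S) :
  exists! w : vector S, is_vsum u v w.
Proof.
destruct (vclass_surj u) as (A & B & eu), (vclass_surj v) as (C & D & ev).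
destruct (transport_tail_all C D B) as (L & hL & _).
exists (vclass (arrow_add (A, B) (B, L) eq_refl)); split.
- exists A, B, C, D, B, A, L; repeat split; try assumption.
  + apply aequiv_refl.
  + now apply vclass_eq; symmetry; apply vclass_eq.
- intros w (A' & B' & C' & D' & P & K & L' & eu' & ev' & h1 & h2 & ->).
  apply vclass_eq, aequivP; intros [E F].
  rewrite !inner_add; f_equal; apply aequivP, vclass_eq.
  + rewrite <- eu, eu'; symmetry; now apply vclass_eq.
  + apply vclass_eq in hL, h2; congruence.
Qed.

Lemma is_vsum_ex {S : arrow_space} (u v : vector S) :
  exists w : vector S, is_vsum u v w.
Proof.
destruct (is_vsum_ex_unique u v) as (w & hw & _); now exists w.
Qed.

(* By [is_vsum_ex_unique] the description is definite: the sum does not depend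
   on the chosen base point or representatives. *)
Definition vadd {S : arrow_space} (u v : vector S) : vector S :=
  proj1_sig (constructive_indefinite_description _ (is_vsum_ex u v)).

(* Main.v *)
Require Import Defs.
From Stdlib Require Import IndefiniteDescription.

(** With [B] as base point, the arrow from [A] to [B] and its opposite already meet head to tail,
    and they compose to the loop at [A]. By [is_vsum_vadd], one such choice of representatives
    settles the value of [vadd], since any two sums agree. *)

Lemma is_vsum_vadd {S : arrow_space} (u v w : vector S) :
  is_vsum u v w -> vadd u v = w.
Proof.
intro h; unfold vadd.
destruct (constructive_indefinite_description _ _) as [w' h']; simpl.
destruct (is_vsum_ex_unique u v) as (w0 & _ & uniq).
now rewrite <- (uniq w' h'), <- (uniq w h).
Qed.

Theorem theorem55 (S : arrow_space) (A B : S) :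
  vadd (vclass (A, B)) (vclass (arrow_opp (A, B))) = vclass (A, A).
Proof.
apply is_vsum_vadd.
(* Base point [P := B] with [K := L := A]: each transported arrow is the given representative
   itself. *)
exists A, B, B, A, B, A, A; repeat split; apply aequiv_refl.
Qed.
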